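(* Let $d\ge1$, $\gamma>1$, $\beta\in\mathbb{R}$ and $1<r<\infty$. If there is a constant $C_r$ such that $$\|M_{\log,\gamma,\beta}w\|_{L^r(\mathbb{R}^d)}\le C_r\|w\|_{L^r(\mathbb{R}^d)}$$ for every nonnegative $w\in L^r(\mathbb{R}^d)$, then $$2\beta\ge\frac{d(\gamma-1)}{r}.$$ For $r=\infty$, boundedness of $M_{\log,\gamma,\beta}$ on nonnegative $L^\infty$ functions (that is, existence of a constant $C_\infty$ with $\|M_{\log,\gamma,\beta}w\|_{L^\infty}\le C_\infty\|w\|_{L^\infty}$ for every nonnegative $w\in L^\infty(\mathbb{R}^d)$) implies $\beta\ge0$.
   Context: $t_0$ is a fixed number of the form $t_0=2^{-k_1}<e^{-1}$ with $k_1$ an integer, and $a_\gamma(t)=t(\log(1/t))^{\gamma-1}$ for $0<t<e^{-1}$. $\eta$ is a fixed nonnegative radial Schwartz function on $\mathbb{R}^d$ with $\int\eta=1$ and $\eta\ge c\,\mathbf 1_{B(0,1)}$ for some $c>0$; $\eta_t(x)=t^{-d}\eta(x/t)$ and $A_tw=\eta_t*w$. For nonnegative locally integrable $w$ the logarithmic geometric maximal operator is $$M_{\log,\gamma,\beta}w(x)=\sup_{\substack{0<t<t_0\\|y-x|\le a_\gamma(t)}}(\log(1/t))^{-2\beta}A_tw(y).$$ *)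

(* Defs.v *)
From HB Require Import structures.
From mathcomp Require Import all_boot all_order all_algebra.
From mathcomp Require Import all_classical all_reals all_analysis.

Set Implicit Arguments.
Unset Strict Implicit.
Unset Printing Implicit Defensive.

Import Order.TTheory GRing.Theory Num.Theory.
Import numFieldNormedType.Exports.

Local Open Scope classical_set_scope.
Local Open Scope ring_scope.

(* The sigma-algebra on R^n is the one generated by the coordinates, i.e. the
   Borel sigma-algebra. *)
Section measurable_rV.
Context {R : realType} (n : nat).

Let coors : 'I_n -> 'rV[R]_n -> measurableTypeR R := fun i v => v ord0 i.

Let rV_set0 : g_sigma_preimage coors set0.
Proof. exact: sigma_algebra0. Qed.

Let rV_setC A : g_sigma_preimage coors A -> g_sigma_preimage coors (~` A).
Proof. exact: sigma_algebraC. Qed.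

Let rV_bigcup (F : _^nat) : (forall i, g_sigma_preimage coors (F i)) ->
  g_sigma_preimage coors (\bigcup_i (F i)).
Proof. exact: sigma_algebra_bigcup. Qed.

HB.instance Definition _ := @isMeasurable.Build
  (measure_tuple_display default_measure_display)
  'rV[R]_n (g_sigma_preimage coors) rV_set0 rV_setC rV_bigcup.

Lemma measurable_coord (i : 'I_n) :
  measurable_fun [set: 'rV[R]_n] (coors i).
Proof.
move=> _ Y mY; rewrite setTI; apply: sub_sigma_algebra => /=.
rewrite -bigcup_seq/=; exists i => /=; first by rewrite mem_index_enum.
by exists Y => //; rewrite setTI.
Qed.

Lemma measurable_coordP d (T : measurableType d) (f : T -> 'rV[R]_n) :
  (forall i, measurable_fun [set: T] (coors i \o f)) ->
  measurable_fun [set: T] f.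
Proof.
move=> mf _; apply: (@measurability _ _ _ _ _ _
  (\big[setU/set0]_(i < n) preimage_set_system setT (coors i) measurable)) => //.
move=> _ [B + <-]; rewrite -bigcup_seq => -[i _ [A mA <-]].
by rewrite !setTI -comp_preimage -[X in measurable X]setTI; exact: mf.
Qed.

End measurable_rV.

Section lebesgue_rV.
Context {R : realType}.

Definition rV_cons n (z : measurableTypeR R * 'rV[R]_n) : 'rV[R]_n.+1 :=
  \row_i oapp (z.2 ord0) z.1 (unlift ord0 i).

Definition rV_uncons n (v : 'rV[R]_n.+1) : measurableTypeR R * 'rV[R]_n :=
  (v ord0 ord0, \row_i v ord0 (lift ord0 i)).

Lemma rV_consK n : cancel (@rV_cons n) (@rV_uncons n).
Proof.
move=> [x v]; congr pair; first by rewrite mxE unlift_none.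
by apply/rowP => i; rewrite !mxE liftK.
Qed.

Lemma measurable_rV_cons n : measurable_fun setT (@rV_cons n).
Proof.
apply: measurable_coordP => i.
have [j|] := unliftP ord0 i => ->.
  rewrite (_ : _ \o _ = (fun v : 'rV[R]_n => v ord0 j) \o snd).
    by apply: measurableT_comp => //; exact: measurable_coord.
  by apply/funext => -[x v]; rewrite /= mxE liftK.
rewrite (_ : _ \o _ = fst)//.
by apply/funext => -[x v]; rewrite /= mxE unlift_none.
Qed.

Lemma measurable_rV_uncons n : measurable_fun setT (@rV_uncons n).
Proof.
apply: measurable_fun_pair; first exact: measurable_coord.
apply: measurable_coordP => i.
rewrite (_ : _ \o _ = fun v : 'rV[R]_n.+1 => v ord0 (lift ord0 i)).
  exact: measurable_coord.
by apply/funext => v; rewrite /= mxE.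
Qed.

Section cons_measure.
Variables (n : nat) (m : {sigma_finite_measure set 'rV[R]_n -> \bar R}).

Definition cons_measure : set 'rV[R]_n.+1 -> \bar R :=
  pushforward (lebesgue_measure \x m)%E (@rV_cons n).

Let cons_measure0 : cons_measure set0 = 0%E.
Proof. by rewrite /cons_measure /pushforward preimage_set0 measure0. Qed.

Let cons_measure_ge0 A : (0 <= cons_measure A)%E.
Proof. by rewrite /cons_measure /pushforward measure_ge0. Qed.

Let cons_measure_sigma_additive : semi_sigma_additive cons_measure.
Proof.
have mf := @measurable_rV_cons n.
move=> F mF tF mUF; rewrite /cons_measure /pushforward preimage_bigcup.
apply: measure_semi_sigma_additive.
- by move=> k; rewrite -[X in measurable X]setTI; exact: mf.
- apply/trivIsetP => /= i j _ _ ij; rewrite -preimage_setI.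
  by move/trivIsetP : tF => /(_ _ _ _ _ ij) ->//; rewrite preimage_set0.
- by rewrite -preimage_bigcup -[X in measurable X]setTI; exact: mf.
Qed.

HB.instance Definition _ := isMeasure.Build _ _ _ cons_measure
  cons_measure0 cons_measure_ge0 cons_measure_sigma_additive.

Let cons_measure_sigma_finite : sigma_finite setT cons_measure.
Proof.
have /sigma_finiteP[F [TF ndF Foo]] := sigma_finiteT (@lebesgue_measure R).
have /sigma_finiteP[G [TG ndG Goo]] := sigma_finiteT m.
exists (fun k => @rV_uncons n @^-1` (F k `*` G k)).
  rewrite -preimage_bigcup -(preimage_setT (@rV_uncons n)); congr (_ @^-1` _).
  rewrite -setXTT TF TG predeqE => -[x y]; split.
    move=> [/= [k _ Fkx] [l _ Gly]]; exists (maxn k l) => //; split.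
    - by move: x Fkx; exact/subsetPset/ndF/leq_maxl.
    - by move: y Gly; exact/subsetPset/ndG/leq_maxr.
  by move=> [k _ []/= ? ?]; split; exists k.
move=> k; have [mFk Fkoo] := Foo k; have [mGk Gkoo] := Goo k; split.
  rewrite -[X in measurable X]setTI; apply: measurable_rV_uncons => //.
  exact: measurableX.
rewrite /cons_measure /pushforward -comp_preimage.
have -> : @rV_uncons n \o @rV_cons n = id.
  by apply/funext => z /=; exact: rV_consK.
by rewrite preimage_id product_measure1E// lte_mul_pinfty// ge0_fin_numE.
Qed.

HB.instance Definition _ := Measure_isSigmaFinite.Build _ _ _ cons_measure
  cons_measure_sigma_finite.

End cons_measure.

(* Lebesgue measure on R^n, as an iterated product. *)
Fixpoint lebesgue_rV n : {sigma_finite_measure set 'rV[R]_n -> \bar R} :=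
  if n is k.+1 then cons_measure (lebesgue_rV k) else \d_(0 : 'rV[R]_0).

Lemma lebesgue_rV_box n (A : 'I_n -> set (measurableTypeR R)) :
  (forall i, measurable (A i)) ->
  lebesgue_rV n [set v | forall i, A i (v ord0 i)] =
  (\prod_(i < n) lebesgue_measure (A i))%E.
Proof.
elim: n A => [|n IHn] A mA.
  by rewrite big_ord0 /= diracE mem_set// => -[].
have mB : measurable [set v : 'rV[R]_n | forall i, A (lift ord0 i) (v ord0 i)].
  rewrite (_ : [set _ | _] =
      \bigcap_(i in [set: 'I_n]) (fun v : 'rV[R]_n => v ord0 i) @^-1` A (lift ord0 i)).
    apply: fin_bigcap_measurable => // i _.
    by rewrite -[X in measurable X]setTI; exact: (measurable_coord i).
  by apply/seteqP; split => v /= Av i => [_|]; exact: Av.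
rewrite big_ord_recl -IHn//= -product_measure1E//.
rewrite /cons_measure /pushforward; congr (_ _ _).
apply/seteqP; split => -[x v] /=.
  move=> Av; split => /=; first by have := Av ord0; rewrite mxE unlift_none.
  by move=> i; have := Av (lift ord0 i); rewrite mxE liftK.
move=> [/= Ax Av] i; rewrite mxE.
by have [j|] := unliftP ord0 i => ->//=; exact: Av.
Qed.

End lebesgue_rV.

Section maximal_operator.
Context {R : realType} {d : nat}.
Implicit Types (f eta w : 'rV[R]_d -> R) (x y z : 'rV[R]_d).

(* The library norm `|x| on 'rV[R]_d is the sup norm. *)
Definition enorm x : R := Num.sqrt (\sum_(i < d) x ord0 i ^+ 2).

Definition partial (i : 'I_d) f : 'rV[R]_d -> R :=
  fun x => 'D_(delta_mx ord0 i) f x.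

(* partials [:: i1; ..; ik] f = d/dx_i1 (.. (d/dx_ik f)). *)
Definition partials (s : seq 'I_d) f : 'rV[R]_d -> R := foldr partial f s.

Definition smooth f : Prop := forall s : seq 'I_d,
  continuous (partials s f) /\
  forall (i : 'I_d) x, derivable (partials s f) x (delta_mx ord0 i).

Definition schwartz f : Prop := smooth f /\
  forall (a : 'I_d -> nat) (s : seq 'I_d), exists C : R, forall x,
    `|(\prod_(i < d) x ord0 i ^+ a i) * partials s f x| <= C.

Definition radial f : Prop := forall x y, enorm x = enorm y -> f x = f y.

Definition dilate f (t : R) : 'rV[R]_d -> R :=
  fun x => (t ^+ d)^-1 * f (t^-1 *: x).

(* A_t w = eta_t * w, for w >= 0; the value may be +oo. *)
Definition average eta (t : R) w y : \bar R :=
  (\int[lebesgue_rV d]_z (dilate eta t (y - z) * w z)%:E)%E.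

Definition a_gamma (gamma t : R) : R := t * ln t^-1 `^ (gamma - 1).

Definition Mlog (t0 : R) eta (gamma beta : R) w x : \bar R :=
  ereal_sup [set ((ln p.1^-1 `^ (- (2 * beta)))%:E * average eta p.1 w p.2)%E
    | p in [set p : R * 'rV[R]_d |
        0 < p.1 < t0 /\ enorm (p.2 - x) <= a_gamma gamma p.1]].

End maximal_operator.

(* Main.v *)
(* Test the operator on the indicator w of a cube of side comparable to t inside
   B(0,t). The average A_t w(0) is bounded below uniformly in t, so by taking
   y = 0 the maximal function is at least a constant times (log 1/t)^(-2 beta)
   on a cube of side comparable to a_gamma(t). Comparing L^r norms, the ratio of
   the two volumes being (log 1/t)^(d(gamma-1)), bounds
   (log 1/t)^(d(gamma-1)/r - 2 beta) as t -> 0; in L^oo the volumes do not enter.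
   With t = exp(-s), log(1/t) = s. *)
Require Import Defs.
From mathcomp Require Import all_boot all_order all_algebra.
From mathcomp Require Import all_classical all_reals all_analysis.
From mathcomp Require Import measurable_realfun ess_sup_inf ring lra.

Import Order.TTheory GRing.Theory Num.Theory.
Import numFieldNormedType.Exports.

Local Open Scope classical_set_scope.
Local Open Scope ring_scope.

Set Implicit Arguments.
Unset Strict Implicit.
Unset Printing Implicit Defensive.

Import HBNNSimple.

(** * Lower bounds for integrals and norms *)

Section lower_bounds.
Context {d} {T : measurableType d} {R : realType}.
Variable mu : {measure set T -> \bar R}.
Implicit Types (A : set T) (f : T -> \bar R) (k r : R).

Lemma integral_ge_cst A f k : measurable A -> 0 <= k ->
  (forall x, (0 <= f x)%E) -> (forall x, A x -> (k%:E <= f x)%E) ->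
  (k%:E * mu A <= \int[mu]_x f x)%E.
Proof.
move=> mA k0 f0 kf.
have -> : (k%:E * mu A = \int[mu]_x (scale_nnsfun (indic_nnsfun R mA) k0 x)%:E)%E.
  under eq_integral do rewrite /= EFinM.
  rewrite ge0_integralZl_EFin//; first by rewrite integral_indic// setIT.
    by move=> x _; rewrite lee_fin fun_ge0.
  by apply: measurableT_comp => //; exact: measurable_indic.
(* [f] may be non-measurable, so [ge0_le_integral] does not apply; the integral
   of a nonnegative function is a supremum over the simple functions below it. *)
rewrite integral_nnsfun// ge0_integralTE//; apply: ereal_sup_ubound => /=.
exists (scale_nnsfun (indic_nnsfun R mA) k0); last by rewrite patch_setT.
move=> x /=; rewrite /mindic indicE; have [/set_mem Ax|_] := boolP (x \in A).
  by rewrite mulr1; exact: kf.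
by rewrite mulr0.
Qed.

(** Chebyshev's inequality, stated for arbitrary [f] because it is applied to [Mlog], a supremum
    over an uncountable family. *)
Lemma Lnorm_ge_cst A f k r : measurable A -> 0 <= k -> 0 < r ->
  (forall x, A x -> (k%:E <= f x)%E) ->
  (k%:E * mu A `^ r^-1 <= 'N[mu]_r%:E[f])%E.
Proof.
move=> mA k0 r0 kf; rewrite unlock.
have -> : (k%:E * mu A `^ r^-1 = ((k `^ r)%:E * mu A) `^ r^-1)%E.
  by rewrite poweRM ?lee_fin ?powR_ge0// poweR_EFin -powRrM mulfV ?gt_eqF// powRr1.
apply: gt0_ler_poweR; rewrite ?invr_ge0 ?(ltW r0)//.
- by rewrite in_itv/= leey mule_ge0// lee_fin powR_ge0.
- by rewrite in_itv/= leey integral_ge0// => x _; exact: poweR_ge0.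
apply: integral_ge_cst => [//|||x Ax]; [exact: powR_ge0|by move=> x; exact: poweR_ge0|].
rewrite -poweR_EFin; apply: gt0_ler_poweR; rewrite ?(ltW r0)//.
- by rewrite in_itv/= leey lee_fin k0.
- by rewrite in_itv/= leey abse_ge0.
- by rewrite (le_trans (kf _ Ax))// lee_abs.
Qed.

Lemma Lnormy_ge_cst A f k : measurable A -> (0 < mu A)%E ->
  (forall x, A x -> (k%:E <= f x)%E) -> (k%:E <= 'N[mu]_+oo[f])%E.
Proof.
move=> mA A0 kf; rewrite unlock.
(* The norm is 0 by convention on a null space; [A] of positive measure selects the essential
   supremum. *)
have -> : (0 < mu setT)%E by rewrite (lt_le_trans A0)// le_measure ?inE.
rewrite leNgt; apply/negP => /= Nk.
(* [N] is a null set containing every point where [f] exceeds its essential supremum in absolute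
   value; it would contain [A]. *)
have [N [mN N0 AN]] := ess_sup_ge mu (abse \o f).
have : (mu A <= mu N)%E.
  apply: le_measure; rewrite ?inE// => x Ax; apply: AN => /= fx.
  have := le_lt_trans fx Nk; rewrite ltNge => /negP; apply.
  by rewrite (le_trans (kf _ Ax))// lee_abs.
by rewrite N0 leNgt A0.
Qed.

Lemma Lnorm_indic A r : measurable A -> 0 < r ->
  ('N[mu]_r%:E[EFin \o \1_A] = mu A `^ r^-1)%E.
Proof.
move=> mA r0; rewrite unlock; congr poweR.
rewrite -[in RHS](setIT A) -integral_indic//; apply: eq_integral => x _ /=.
by rewrite indicE; case: (x \in A); rewrite ?normr1 ?powR1// normr0 powR0// gt_eqF.
Qed.

Lemma Lnormy_indic A : ('N[mu]_+oo[EFin \o \1_A] <= 1)%E.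
Proof.
rewrite unlock; case: ifPn => // mu0; apply/ess_supP/nearW => x /=.
by rewrite indicE lee_fin ger0_norm; case: (x \in A).
Qed.

End lower_bounds.

(** * Volume and Euclidean size of cubes *)

Section box.
Context {R : realType} {d : nat}.
Implicit Types (e : R) (x : 'rV[R]_d).

Definition box e : set 'rV[R]_d := [set x | forall i, `|x ord0 i| <= e].

Lemma measurable_box e : measurable (box e).
Proof.
rewrite (_ : box e = \bigcap_(i in [set: 'I_d])
    (fun x : 'rV[R]_d => x ord0 i) @^-1` `[- e, e]%classic).
  apply: fin_bigcap_measurable => // i _.
  by rewrite -[X in measurable X]setTI; exact: (measurable_coord i).
apply/seteqP; split => x /= xe i => [_|]; first by rewrite /= in_itv/= -ler_norml.
by have := xe i I; rewrite /= in_itv/= -ler_norml.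
Qed.

Lemma lebesgue_box e : 0 <= e -> lebesgue_rV d (box e) = ((2 * e) ^+ d)%:E.
Proof.
move=> e0; rewrite (_ : box e =
    [set x | forall i : 'I_d, `[- e, e]%classic (x ord0 i)]).
  rewrite (lebesgue_rV_box (A := fun=> `[- e, e]%classic))//.
  rewrite (eq_bigr (fun=> (2 * e)%:E)) => [|i _].
    by rewrite -(big_morph EFin EFinM erefl) prodr_const card_ord.
  (* The interval length branches on [- e < e]; at [e = 0] the default value 0 agrees with
     [2 * e]. *)
  rewrite lebesgue_measure_itv/= lte_fin -subr_gt0 -EFinB opprK -mulr2n -[e *+ 2]mulr_natl.
  by rewrite pmulr_rgt0//; case: ltgtP e0 => // <- _; rewrite mulr0.
by apply/seteqP; split => x /= xe i; have := xe i; rewrite in_itv/= -ler_norml.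
Qed.

(** The sharp factor is the square root of [d]; the cruder [d] follows from [d <= d ^ 2] and only
    affects constants. *)
Lemma enorm_box e x : 0 <= e -> box e x -> enorm x <= d%:R * e.
Proof.
move=> e0 xe; rewrite -[leRHS]ger0_norm ?mulr_ge0// -sqrtr_sqr ler_wsqrtr// exprMn.
rewrite (@le_trans _ _ (\sum_(i < d) e ^+ 2))//.
  apply: ler_sum => i _; rewrite -real_normK ?num_real//.
  by rewrite ler_sqr ?nnegrE//; exact: xe.
rewrite sumr_const card_ord -[leLHS]mulr_natl ler_wpM2r ?sqr_ge0//.
by rewrite -natrX ler_nat; case: (d) => // n; rewrite leq_pmulr.
Qed.

End box.

(** A positive power is unbounded at infinity; this turns a norm inequality uniform in small t into
    a condition on exponents. *)
Lemma powR_bounded_le0 (R : realType) (p s0 K : R) :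
  (forall s, s0 < s -> 0 < s -> s `^ p <= K) -> p <= 0.
Proof.
move=> ub; rewrite leNgt; apply/negP => p0.
have K0 : 0 < `|K| + 1 by rewrite ltr_pwDr.
(* This [s] lies beyond [s0] and satisfies [s ^ p >= |K| + 1 > K]. *)
pose s : R := `|s0| + 1 + (`|K| + 1) `^ p^-1.
have [s0s sK] : s0 < s /\ (`|K| + 1) `^ p^-1 <= s.
  have := powR_ge0 (`|K| + 1) p^-1; have := ler_norm s0; have := normr_ge0 s0.
  rewrite /s; move: ((_ + 1) `^ _) (`|s0|) => u v v0 sv u0; split; lra.
have spos : 0 < s by rewrite (lt_le_trans _ sK)// powR_gt0.
have := ub _ s0s spos; apply/negP; rewrite -ltNge.
apply: (@lt_le_trans _ _ (`|K| + 1)); first by have := ler_norm K; lra.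
rewrite -[leLHS]powRr1 ?(ltW K0)// -[X in _ `^ X <= _](mulVf (lt0r_neq0 p0)) powRrM.
by apply: (ge0_ler_powR (ltW p0)) => //; rewrite nnegrE ?powR_ge0 ?(ltW spos).
Qed.

(* Chosen so that the cube [box (box_scale R d * t)] lies in the open Euclidean
   ball of radius [t]. *)
Definition box_scale (R : realType) (d : nat) : R := d.+1%:R^-1.

(** * The maximal function of a small cube *)

Section extremal_example.
Context {R : realType} {d : nat}.
Variables (t0 c gamma beta : R) (eta : 'rV[R]_d -> R).
Hypotheses (t0_gt0 : 0 < t0) (eta_ge0 : forall x, 0 <= eta x) (c_gt0 : 0 < c).
Hypothesis eta_ge :
  forall x, c * \1_[set y : 'rV[R]_d | enorm y < 1] x <= eta x.

Local Notation rho := (box_scale R d).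

Lemma box_scale_gt0 : 0 < rho.
Proof. by rewrite invr_gt0. Qed.

Lemma enorm_box_scale (e : R) (x : 'rV[R]_d) : 0 < e -> box (rho * e) x -> enorm x < e.
Proof.
move=> e0 /enorm_box => /(_ (ltW (mulr_gt0 box_scale_gt0 e0))) /le_lt_trans; apply.
by rewrite mulrA gtr_pMl// /box_scale ltr_pdivrMr// mul1r ltr_nat.
Qed.

(** For z in the cube, z / t lies in the open unit ball, where [eta >= c]; the factor [t ^- d] of
    the dilation cancels the t-dependence of the cube's volume. *)
Lemma average_indic_box t : 0 < t ->
  ((c * (2 * rho) ^+ d)%:E <= average eta t \1_(box (rho * t)) 0)%E.
Proof.
move=> t_gt0; have rt0 := mulr_gt0 box_scale_gt0 t_gt0.
have -> : ((c * (2 * rho) ^+ d)%:E =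
    (t ^- d * c)%:E * lebesgue_rV d (box (rho * t)))%E.
  rewrite lebesgue_box ?ltW// -EFinM (mulrA 2) [in RHS]exprMn (mulrC _ c) mulrACA.
  by rewrite mulVf ?mulr1// expf_neq0// gt_eqF.
apply: integral_ge_cst; first exact: measurable_box.
- by rewrite mulr_ge0 ?invr_ge0 ?exprn_ge0 ?ltW.
- move=> z; rewrite lee_fin indicE mulr_ge0 ?ler0n// mulr_ge0 ?eta_ge0//.
  by rewrite invr_ge0 exprn_ge0 ?ltW.
move=> z zt; rewrite lee_fin indicE mem_set// mulr1 ler_wpM2l//.
  by rewrite invr_ge0 exprn_ge0 ?ltW.
apply: le_trans (eta_ge _); rewrite indicE mem_set ?mulr1//=.
have : box (rho * 1) (t^-1 *: (0 - z)).
  move=> i; rewrite !mxE add0r normrM normrN gtr0_norm ?invr_gt0//.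
  by rewrite ler_pdivrMl// mulr1 mulrC; exact: zt.
exact: enorm_box_scale.
Qed.

Lemma Mlog_indic_box s x : - ln t0 < s -> 0 < s ->
  box (rho * a_gamma gamma (expR (- s))) x ->
  ((s `^ (- (2 * beta)) * (c * (2 * rho) ^+ d))%:E <=
   Mlog t0 eta gamma beta \1_(box (rho * expR (- s))) x)%E.
Proof.
move=> t0s s0 xa; have lnE : ln (expR (- s))^-1 = s by rewrite -expRN opprK expRK.
apply: (@le_trans _ _ ((s `^ (- (2 * beta)))%:E *
    average eta (expR (- s)) \1_(box (rho * expR (- s))) 0)%E).
  by rewrite EFinM lee_wpmul2l ?lee_fin ?powR_ge0// average_indic_box ?expR_gt0.
(* The centre 0 is admissible for every such [x]: the cube lies in the ball of radius [a_gamma], and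
   [- ln t0 < s] says that t is below [t0]. *)
apply: ereal_sup_ubound; exists (expR (- s), 0); last by rewrite /= lnE.
split => /=.
  by rewrite expR_gt0/= -[ltRHS]lnK ?posrE// ltr_expR ltrNl.
apply/ltW/enorm_box_scale; first by rewrite mulr_gt0 ?expR_gt0// lnE powR_gt0.
by move=> i; rewrite !mxE add0r normrN; exact: xa.
Qed.

End extremal_example.

(** * Comparison of norms as t tends to 0 *)

Theorem proposition7p2 (R : realType) (d : nat) (k1 : int) (t0 c : R)
    (eta : 'rV[R]_d -> R) (gamma beta : R)
    (d_ge1 : (1 <= d)%N)
    (t0E : t0 = 2 ^ (- k1)) (t0_lt : t0 < expR (-1))
    (eta_ge0 : forall x, 0 <= eta x)
    (eta_radial : radial eta)
    (eta_schwartz : schwartz eta)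
    (eta_int : (\int[lebesgue_rV d]_x (eta x)%:E)%E = 1%E)
    (c_gt0 : 0 < c)
    (eta_ge : forall x, c * \1_[set y : 'rV[R]_d | enorm y < 1] x <= eta x)
    (gamma_gt1 : 1 < gamma) :
  (forall r : R, 1 < r ->
    (exists C : R, forall w : 'rV[R]_d -> R,
      w \in Lfun (lebesgue_rV d) r%:E -> (forall x, 0 <= w x) ->
      ('N[lebesgue_rV d]_r%:E [Mlog t0 eta gamma beta w] <=
        C%:E * 'N[lebesgue_rV d]_r%:E [EFin \o w])%E) ->
    d%:R * (gamma - 1) / r <= 2 * beta) /\
  ((exists C : R, forall w : 'rV[R]_d -> R,
      w \in Lfun (lebesgue_rV d) +oo%E -> (forall x, 0 <= w x) ->
      ('N[lebesgue_rV d]_+oo [Mlog t0 eta gamma beta w] <=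
        C%:E * 'N[lebesgue_rV d]_+oo [EFin \o w])%E) ->
    0 <= beta).
Proof.
have t0_gt0 : 0 < t0 by rewrite t0E exprz_gt0.
set rho := box_scale R d; have rho_gt0 : 0 < rho by exact: box_scale_gt0.
pose k := c * (2 * rho) ^+ d.
have k_gt0 : 0 < k by rewrite mulr_gt0// exprn_gt0// mulr_gt0.
pose e s := rho * expR (- s); pose a s := rho * a_gamma gamma (expR (- s)).
have e_gt0 s : 0 < e s by rewrite mulr_gt0 ?expR_gt0.
(* The ratio of the two half-sides is a pure power of [s], and so is the ratio of volumes. *)
have aE s : a s = e s * s `^ (gamma - 1).
  by rewrite /a /a_gamma -expRN opprK expRK mulrA.
have a_gt0 s : 0 < s -> 0 < a s by move=> s0; rewrite aE mulr_gt0 ?powR_gt0.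
have MlogE s x : - ln t0 < s -> 0 < s -> box (a s) x ->
    ((s `^ (- (2 * beta)) * k)%:E <= Mlog t0 eta gamma beta \1_(box (e s)) x)%E.
  exact: Mlog_indic_box.
have c_ge0 s : 0 <= s `^ (- (2 * beta)) * k by rewrite mulr_ge0 ?powR_ge0 ?ltW.
have mw s : (\1_(box (e s)) : 'rV[R]_d -> R) \in mfun.
  by rewrite inE/=; apply: measurable_indic; exact: measurable_box.
split=> [r r1 [C bdC]|[C bdC]].
- have r0 : 0 < r by rewrite (lt_trans _ r1).
  rewrite -subr_le0; apply: (@powR_bounded_le0 _ _ (- ln t0) (C / k)) => s t0s s0.
  pose X := ((2 * e s) ^+ d) `^ r^-1.
  have X_gt0 : 0 < X by rewrite powR_gt0// exprn_gt0// mulr_gt0.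
  have Nw : ('N[lebesgue_rV d]_r%:E[EFin \o \1_(box (e s))] = X%:E)%E.
    rewrite Lnorm_indic//; last exact: measurable_box.
    by rewrite [X in (X `^ _)%E]lebesgue_box ?(ltW (e_gt0 s)).
  have wL : (\1_(box (e s)) : 'rV[R]_d -> R) \in Lfun (lebesgue_rV d) r%:E.
    by apply/andP; split; [exact: mw|rewrite inE/= /finite_norm Nw ltry].
  have := le_trans (Lnorm_ge_cst _ (measurable_box (a s)) (c_ge0 s) r0
    (fun x => MlogE s x t0s s0)) (bdC _ wL (fun x => ler0n _ _)).
  rewrite Nw [X in (_ * X `^ _)%E]lebesgue_box ?(ltW (a_gt0 s s0))//.
  rewrite poweR_EFin -!EFinM lee_fin aE mulrA exprMn.
  rewrite powRM ?exprn_ge0 ?powR_ge0 ?mulr_ge0 ?(ltW rho_gt0) ?expR_ge0//.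
  rewrite -[s `^ (gamma - 1) ^+ d]powR_mulrn ?powR_ge0// -!powRrM -/X => bd.
  (* The norm [X] of the test function occurs on both sides; cancelling it leaves the bound [C / k],
     independent of [s]. *)
  rewrite ler_pdivlMr// -(ler_pM2r X_gt0) (le_trans _ bd)//.
  rewrite powRD; last by rewrite (gt_eqF s0) implybT.
  by rewrite (mulrC d%:R) (mulrA (gamma - 1)) le_eqVlt; apply/orP; left; apply/eqP; ring.
- rewrite -(pmulr_rge0 _ (ltr0n _ 2)) -oppr_le0.
  (* The test function only has norm at most 1, so [C], of unknown sign, is first replaced by
     [|C|]. *)
  apply: (@powR_bounded_le0 _ _ (- ln t0) (`|C| / k)) => s t0s s0.
  have wL : (\1_(box (e s)) : 'rV[R]_d -> R) \in Lfun (lebesgue_rV d) +oo%E.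
    apply/andP; split; first exact: mw.
    by rewrite inE/= /finite_norm (le_lt_trans (Lnormy_indic _ _))// ltry.
  rewrite ler_pdivlMr// -lee_fin.
  have vol_gt0 : (0 < lebesgue_rV d (box (a s)))%E.
    rewrite lebesgue_box ?(ltW (a_gt0 s s0))// lte_fin exprn_gt0//.
    by rewrite mulr_gt0// a_gt0.
  apply: le_trans (le_trans (Lnormy_ge_cst (measurable_box (a s)) vol_gt0
    (fun x => MlogE s x t0s s0)) (bdC _ wL (fun x => ler0n _ _))) _.
  rewrite (@le_trans _ _ (`|C|%:E * 'N[lebesgue_rV d]_+oo[EFin \o \1_(box (e s))])%E)//.
    by rewrite lee_wpmul2r ?Lnorm_ge0// lee_fin ler_norm.
  by rewrite -[leRHS]mule1 lee_wpmul2l ?Lnormy_indic.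
Qed.
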